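(* Let $X$ be a PSCA$(t+1,t,1)$, let $v=t+1$, let $w\in[v]$, and let $0\le i\le t$. Then for any $i$-element subset $I\subseteq[v]\setminus\{w\}$, $$d_{I,w}=\frac{d_w(i)}{\binom{t}{i}}.$$
   Context: For positive integers $v\ge t$, let $[v]=\{0,\dots,v-1\}$, let $\mathcal{S}_v$ be the set of permutations of $[v]$ (bijections $[v]\to[v]$), and let $\mathcal{S}_{v,t}$ be the set of ordered sequences of $t$ distinct elements of $[v]$. A sequence $s=(s_0,\dots,s_{t-1})\in\mathcal{S}_{v,t}$ is covered by $\pi\in\mathcal{S}_v$ if $\pi^{-1}(s_i)<\pi^{-1}(s_{i+1})$ for $0\le i\le t-2$. For a positive integer $\lambda$, a PSCA$(v,t,\lambda)$ is a multiset $X$ of permutations in $\mathcal{S}_v$ such that every sequence in $\mathcal{S}_{v,t}$ is covered by exactly $\lambda$ permutations in $X$ (counted with multiplicity). For $w\in[v]$ and $0\le i\le v-1$, $d_w(i)=|\{\pi\in X:\pi(i)=w\}|$. For $w\in[v]$ and $I\subseteq[v]\setminus\{w\}$ with $|I|=i$, $d_{I,w}$ is the number of permutations $\pi\in X$ such that $\pi(i)=w$ and $I=\{\pi(j):0\le j\le i-1\}$. All counts are with multiplicity. *)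

(* Defs.v *)
From mathcomp Require Export all_boot all_order all_algebra all_fingroup.
From mathcomp Require Export finmap multiset.

Set Implicit Arguments.
Unset Strict Implicit.
Unset Printing Implicit Defensive.

Local Open Scope mset_scope.

(* A permutation [p : 'S_v] is read as the word [p 0, ..., p (v - 1)], so that
   [p^-1 x] is the position of the symbol [x].  A multiset [X : {mset 'S_v}]
   coerces to its multiplicity function. *)

Definition covered (v : nat) (p : 'S_v) (s : seq 'I_v) : bool :=
  sorted (fun x y : 'I_v => (p^-1)%g x < (p^-1)%g y) s.

Definition mcount (v : nat) (X : {mset 'S_v}) (P : pred 'S_v) : nat :=
  \sum_(p : 'S_v | P p) X p.

Definition PSCA (v t lambda : nat) (X : {mset 'S_v}) : Prop :=
  forall s : t.-tuple 'I_v, uniq s -> mcount X (fun p => covered p s) = lambda.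

Definition d_elt (v : nat) (X : {mset 'S_v}) (w i : 'I_v) : nat :=
  mcount X (fun p => p i == w).

(* Used with [i = #|I|]: the position [i] is an argument because it has to be
   an element of ['I_v]. *)
Definition d_set (v : nat) (X : {mset 'S_v}) (i : 'I_v) (I : {set 'I_v})
    (w : 'I_v) : nat :=
  mcount X (fun p => (p i == w) && (I == [set p j | j : 'I_v & j < i])).

(* Main.v *)
Require Import Defs.
Import GRing.Theory Num.Theory.
Local Open Scope ring_scope.

(** Fix [w] and let [f A] be the number of permutations of [X] in which [A] is
    exactly the set of symbols standing before [w].  Take [x] outside [J] and
    different from [w].  Deleting [x] from a permutation leaves an injective
    word of length [t], and that word has [J] before [w] exactly when the
    permutation has [J] or [x |: J] before [w].  Since [X] covers each injective
    word of length [t] once, [f J + f (x |: J)] is the number of injective words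
    of length [t] that avoid [x] and have [J] before [w]
    ([mcount_before_setU1]).

    If [y] is another such symbol, swapping [x] and [y] is a bijection from
    these words to the corresponding words avoiding [y], because it fixes [w]
    and every element of [J].  The term [f J] cancels and leaves
    [f (x |: J) = f (y |: J)] ([mcount_before_exchange]).  Such exchanges connect
    any two sets of the same size, so [f A] depends only on the size of [A]
    ([mcount_before_card]).  The number of permutations with [w] in position
    [i] is the sum of [f A] over the ['C(t, i)] sets [A] of size [i] avoiding
    [w], and all terms of this sum are equal. *)

Section Counting.

Set Implicit Arguments.
Unset Strict Implicit.
Unset Printing Implicit Defensive.
Local Open Scope nat_scope.

Definition before (v : nat) (p : 'S_v) (w : 'I_v) : {set 'I_v} :=
  [set z | (p^-1)%g z < (p^-1)%g w].

Definition word_before (v : nat) (s : seq 'I_v) (w : 'I_v) : {set 'I_v} :=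
  [set z | index z s < index w s].

Definition word_avoiding (v t : nat) (x : 'I_v) (s : t.-tuple 'I_v) : bool :=
  uniq s && (x \notin s).

Lemma before_notin (v : nat) (p : 'S_v) (w : 'I_v) : w \notin before p w.
Proof. by rewrite inE ltnn. Qed.

Lemma card_before (v : nat) (p : 'S_v) (w : 'I_v) :
  #|before p w| = (p^-1)%g w.
Proof.
set k := (p^-1)%g w.
have -> : before p w = p @: [set j : 'I_v | j < k].
  apply/setP=> z; rewrite inE; apply/idP/imsetP => [zk | [j]].
    by exists ((p^-1)%g z); rewrite ?inE // permKV.
  by rewrite inE => jk ->; rewrite permK.
rewrite card_imset; last exact: perm_inj.
rewrite -sum1dep_card -(big_ord_widen _ (fun=> 1)); last exact: ltnW.
by rewrite sum1_card card_ord.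
Qed.

(** The position [i] is determined by [A], since [w] stands in position
    [#|before p w|].  Hence the two conditions reduce to one on [before]. *)
Lemma before_eq_prefix (v : nat) (p : 'S_v) (w i : 'I_v) (A : {set 'I_v}) :
  #|A| = i ->
  (p i == w) && (A == [set p j | j : 'I_v & j < i]) = (before p w == A).
Proof.
move=> cA.
have prefixE : p i = w -> [set p j | j : 'I_v & j < i] = before p w.
  move=> <-; apply/setP=> z; rewrite inE permK; apply/imsetP/idP => [[j]|zi].
    by rewrite inE => ji ->; rewrite permK.
  by exists ((p^-1)%g z); rewrite ?inE // permKV.
apply/andP/eqP => [[/eqP piw /eqP ->] | bA]; first by rewrite prefixE.
have piw : p i = w.
  apply: (canLR (permKV p)); apply: val_inj.
  by rewrite /= -card_before bA cA.
by rewrite prefixE // piw bA !eqxx.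
Qed.

Section OneWord.

Variables (t : nat) (p : 'S_t.+1) (x : 'I_t.+1).

Let precedes : rel 'I_t.+1 := fun a b => (p^-1)%g a < (p^-1)%g b.

Let precedes_trans : transitive precedes.
Proof. by move=> b a c; apply: ltn_trans. Qed.

Let precedes_irr : irreflexive precedes.
Proof. by move=> a; apply: ltnn. Qed.

Lemma mem_word_avoiding (s : t.-tuple 'I_t.+1) :
  word_avoiding x s -> s =i predC1 x.
Proof.
case/andP=> us xs; have sub : {subset s <= predC1 x}.
  by move=> z zs; rewrite inE /=; apply: contraNneq xs => <-.
have cs : #|s| = #|predC1 x|.
  by rewrite cardC1 card_ord (card_uniqP us) size_tuple.
by apply/(subset_cardP cs)/subsetP.
Qed.

(** The covered word is [p] read as a word with [x] deleted: it is the sorted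
    enumeration of the other symbols, and a strict order has only one. *)
Lemma covered_word_unique :
  \sum_(s : t.-tuple 'I_t.+1 | word_avoiding x s) covered p s = 1.
Proof.
pose s0 := [seq z <- [seq p j | j <- enum 'I_t.+1] | z != x].
have s0E : s0 =i predC1 x.
  move=> z; rewrite mem_filter !inE; case: (z == x) => //=.
  by rewrite -[z](permKV p) map_f // mem_enum.
have us0 : uniq s0.
  by rewrite filter_uniq // map_inj_uniq ?enum_uniq //; exact: perm_inj.
have sz0 : size s0 == t.
  by rewrite -(card_uniqP us0) (eq_card s0E) cardC1 card_ord.
have cov0 : covered p s0.
  apply: (sorted_filter precedes_trans); rewrite sorted_map.
  rewrite (eq_sorted (e' := relpre val ltn)) => [|a b]; last first.
    by rewrite /relpre /= /precedes !permK.
  by rewrite -sorted_map val_enum_ord iota_ltn_sorted.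
rewrite (bigD1 (Tuple sz0)) /=; last first.
  by rewrite /word_avoiding us0 s0E inE /= eqxx.
rewrite cov0 big1 ?addn0 // => s /andP[avs].
apply: contraNeq; rewrite eqb0 negbK => covs; apply/eqP/val_inj => /=.
apply: (irr_sorted_eq precedes_trans precedes_irr covs cov0) => z.
by rewrite (mem_word_avoiding avs) s0E.
Qed.

Lemma covered_before (s : t.-tuple 'I_t.+1) (w : 'I_t.+1) :
  word_avoiding x s -> w != x -> covered p s ->
  word_before s w = before p w :\ x.
Proof.
move=> avs wx covs; apply/setP=> z; rewrite !inE.
have memE := mem_word_avoiding avs.
have ws : w \in s by rewrite memE inE.
have [-> /= | zx /=] := eqVneq z x.
  (* The index of the absent symbol [x] is [size s], so [x] is not counted as
     standing before [w]. *)
  have xs : x \notin s by case/andP: avs.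
  by rewrite (memNindex xs) ltnNge index_size.
have zs : z \in s by rewrite memE inE.
have lt_index a b : a \in s -> b \in s -> index a s < index b s -> precedes a b.
  exact: (sorted_ltn_index precedes_trans covs).
apply/idP/idP => [/(lt_index _ _ zs ws) // | pzw].
rewrite ltnNge leq_eqVlt negb_or; apply/andP; split.
  apply/eqP=> /(index_inj w ws zs) wz.
  by rewrite wz ltnn in pzw.
by apply/negP=> /(lt_index _ _ ws zs); rewrite /precedes ltnNge ltnW.
Qed.

End OneWord.

(** Both sides count the permutations that have [J] before [w] once [x] is
    deleted; the right-hand side sorts them by the word that remains. *)
Lemma mcount_before_setU1 (t : nat) (X : {mset 'S_t.+1}%mset) (w x : 'I_t.+1)
    (J : {set 'I_t.+1}) :
  PSCA t 1 X -> w != x -> x \notin J ->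
  mcount X (fun p => before p w == J) + mcount X (fun p => before p w == x |: J)
  = \sum_(s : t.-tuple 'I_t.+1 | word_avoiding x s) (word_before s w == J).
Proof.
move=> hX wx xJ.
have D1_id (A : {set 'I_t.+1}) : x \notin A -> A :\ x = A.
  by move=> xA; apply/setDidPl; rewrite disjoint_sym disjoints1.
have -> : mcount X (fun p => before p w == J) +
          mcount X (fun p => before p w == x |: J) =
          mcount X (fun p => before p w :\ x == J).
  rewrite /mcount (bigID (fun p => x \in before p w)
    (fun p => before p w :\ x == J)) addnC /=.
  congr (_ + _); apply: eq_bigl => p; apply/eqP/andP => [bE | [/eqP bE xb]].
  - by rewrite bE setU1K // setU11.
  - by rewrite -bE setD1K.
  - by rewrite bE xJ D1_id.
  - by rewrite -bE D1_id.
(* Double counting of the pairs formed by a permutation of [X] and the one word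
   avoiding [x] that it covers. *)
transitivity (\sum_(p : 'S_t.+1) \sum_(s : t.-tuple 'I_t.+1 | word_avoiding x s)
    X p * (covered p s * (word_before s w == J))).
  rewrite /mcount big_mkcond; apply: eq_bigr => p _.
  transitivity (\sum_(s : t.-tuple 'I_t.+1 | word_avoiding x s)
      X p * (covered p s * (before p w :\ x == J))).
    rewrite -big_distrr -big_distrl covered_word_unique /= mul1n.
    by case: eqP; rewrite (muln1, muln0).
  apply: eq_bigr => s avs.
  by case: (boolP (covered p s)) => // /(covered_before avs wx) ->.
rewrite exchange_big; apply: eq_bigr => s /andP[us _] /=.
rewrite (eq_bigr (fun p => X p * covered p s * (word_before s w == J))); last first.
  by move=> p _; rewrite mulnA.
rewrite -big_distrl /= -[RHS]mul1n -(hX s us) /mcount [in RHS]big_mkcond /=.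
congr (_ * _); apply: eq_bigr => p _.
by case: (covered p s); rewrite (muln1, muln0).
Qed.

(** Swapping [x] and [y] in words matches the right-hand sides of
    [mcount_before_setU1] for [x] and for [y], and the summand for [J] is common
    to both left-hand sides. *)
Lemma mcount_before_exchange (t : nat) (X : {mset 'S_t.+1}%mset)
    (w x y : 'I_t.+1) (J : {set 'I_t.+1}) :
  PSCA t 1 X -> w != x -> w != y -> x \notin J -> y \notin J ->
  mcount X (fun p => before p w == x |: J) =
  mcount X (fun p => before p w == y |: J).
Proof.
move=> hX wx wy xJ yJ.
apply/(@addnI (mcount X (fun p => before p w == J))).
rewrite !mcount_before_setU1 //; set s0 := tperm x y.
have swK : involutive s0 by exact: tpermK.
pose h (s : t.-tuple 'I_t.+1) : t.-tuple 'I_t.+1 := map_tuple s0 s.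
have hK : involutive h.
  by move=> s; apply: val_inj; rewrite /= -map_comp map_id_in // => z _ /=.
rewrite (reindex_inj (inv_inj hK)).
have memh z (s : t.-tuple 'I_t.+1) : (z \in h s) = (s0 z \in s).
  by rewrite -[z in LHS]swK mem_map //; exact: perm_inj.
have indh z (s : t.-tuple 'I_t.+1) : index z (h s) = index (s0 z) s.
  by rewrite -[z in LHS]swK index_map //; exact: perm_inj.
have s0w : s0 w = w by rewrite tpermD // eq_sym.
have s0J z : (s0 z \in J) = (z \in J).
  by rewrite /s0; case: tpermP => // ->; rewrite (negPf xJ) (negPf yJ).
apply: eq_big => [s | s _].
  by rewrite /word_avoiding memh tpermL map_inj_uniq //; exact: perm_inj.
congr nat_of_bool; apply/eqP/eqP => /setP bJ; apply/setP=> z.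
  by rewrite -s0J -bJ !inE !indh s0w swK.
by rewrite inE !indh s0w -s0J -bJ inE.
Qed.

(** Exchanging an element of [A :\: B] for one of [B :\: A] brings [A] closer to
    [B], so this is an induction on the size of [A :\: B]. *)
Lemma mcount_before_card (t : nat) (X : {mset 'S_t.+1}%mset) (w : 'I_t.+1)
    (A B : {set 'I_t.+1}) :
  PSCA t 1 X -> w \notin A -> w \notin B -> #|A| = #|B| ->
  mcount X (fun p => before p w == A) = mcount X (fun p => before p w == B).
Proof.
move=> hX; have [n] := ubnP #|A :\: B|.
elim: n A => // n IHn A ltn wA wB cAB.
have [AB0 | [x]] := set_0Vmem (A :\: B).
  have /eqP -> // : A == B.
  by rewrite eqEcard cAB leqnn -finset.setD_eq0 AB0 eqxx.
rewrite inE => /andP[xB xA].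
have [BA0 | [y]] := set_0Vmem (B :\: A).
  have /eqP BA : B == A by rewrite eqEcard cAB leqnn -finset.setD_eq0 BA0 eqxx.
  by rewrite BA xA in xB.
rewrite inE => /andP[yA yB].
have wx : w != x by apply: contraNneq wA => ->.
have wy : w != y by apply: contraNneq wB => ->.
have yAx : y \notin A :\ x by rewrite inE negb_and yA orbT.
rewrite -[A in LHS](setD1K xA) (@mcount_before_exchange _ _ _ x y) ?setD11 //.
apply: IHn => //.
- have := ltn; rewrite (cardsD1 x (A :\: B)) !inE xB xA /= ltnS.
  apply: leq_ltn_trans; apply: subset_leq_card; apply/subsetP=> z.
  rewrite !inE => /andP[zB /orP[/eqP zy | /andP[zx zA]]].
    by rewrite zy yB in zB.
  by rewrite zx zB zA.
- by rewrite !inE negb_or wy negb_and wA orbT.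
- by rewrite cardsU1 yAx -cAB (cardsD1 x A) xA.
Qed.

Lemma d_eltE (t : nat) (X : {mset 'S_t.+1}%mset) (w i : 'I_t.+1) :
  d_elt X w i =
  \sum_(A : {set 'I_t.+1} | (A \subset [set~ w]) && (#|A| == i))
     mcount X (fun p => before p w == A).
Proof.
rewrite /d_elt /mcount (partition_big (fun p => before p w)
  (fun A : {set 'I_t.+1} => (A \subset [set~ w]) && (#|A| == i))) /=.
  apply: eq_bigr => A /andP[_ /eqP cA]; apply: eq_bigl => p.
  apply/andP/idP=> [[] // | bA]; split=> //.
  by move: bA; rewrite -(before_eq_prefix p w cA) => /andP[].
move=> p /eqP <-; rewrite card_before permK eqxx andbT.
by apply/subsetP=> z zb; rewrite !inE; apply: contraTneq zb => ->;
  rewrite before_notin.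
Qed.

End Counting.

Theorem theorem2p5 (t : nat) (ht : (0 < t)%N) (X : {mset 'S_(t.+1)}%mset)
    (hX : PSCA t 1 X) (w i : 'I_(t.+1)) (I : {set 'I_(t.+1)})
    (hI : I \subset [set~ w]) (hcard : #|I| = i) :
  (d_set X i I w)%:R = (d_elt X w i)%:R / 'C(t, i)%:R :> rat.
Proof.
have notin (A : {set 'I_t.+1}) : A \subset [set~ w] -> w \notin A.
  by move=> /subsetP Aw; apply/negP=> /Aw; rewrite !inE eqxx.
have eltE : d_elt X w i = ('C(t, i) * d_set X i I w)%N.
  rewrite d_eltE (eq_bigr (fun=> d_set X i I w)) => [|A /andP[Aw /eqP cA]].
    rewrite sum_nat_const; congr (_ * _)%N.
    by have := cards_draws [set~ w] i; rewrite cardsC1 card_ord cardsE.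
  rewrite (mcount_before_card hX (notin A Aw) (notin I hI)) ?cA //.
  by apply: eq_bigl => p; rewrite before_eq_prefix.
have binom0 : 'C(t, i)%:R != 0 :> rat.
  by rewrite pnatr_eq0 -lt0n bin_gt0 -ltnS.
by rewrite eltE natrM mulrC mulKf.
Qed.
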